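(* (Six-slopes formula.) Let $p_0,p_1,p_2,p_3$ be distinct points in the plane with pairwise distinct $x$-coordinates, and let $a_{ij}$ be the slope of the line through $p_i$ and $p_j$; write $a_i=a_{0i}$. Then $$(a_1-a_{12})(a_2-a_{23})(a_3-a_{13})-(a_1-a_{13})(a_2-a_{12})(a_3-a_{23})=0 .$$
   Context: If $p_i=(x_i,y_i)$ and $p_j=(x_j,y_j)$ with $x_i\ne x_j$, the slope is $a_{ij}=a_{ji}=\frac{y_j-y_i}{x_j-x_i}\in\mathbb{R}$. *)

(* Defs.v *)
From mathcomp Require Import all_boot all_order all_algebra.
From mathcomp Require Import reals.

Set Implicit Arguments.
Unset Strict Implicit.
Unset Printing Implicit Defensive.

Import GRing.Theory.
Local Open Scope ring_scope.

(* A point of the plane is a pair (x, y) : R * R.  Since division is total, the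
   value is meaningful as a slope only when p.1 != q.1. *)
Definition slope (R : realType) (p q : R * R) : R :=
  (q.2 - p.2) / (q.1 - p.1).

Lemma slopeC (R : realType) (p q : R * R) : slope p q = slope q p.
Proof.
by rewrite /slope -(opprB q.1 p.1) -(opprB q.2 p.2) invrN mulrNN.
Qed.

(* Main.v *)
(* With D(i,j,k) the determinant of the triangle p_i p_j p_k, two slopes sharing
   the vertex p_j satisfy
     a_ij - a_jk = D(i,j,k) / ((x_j - x_i) (x_k - x_j))  up to sign.
   Each of the two products involves D(0,1,2), D(0,1,3), D(0,2,3) once and the
   same denominators, and the signs agree; clearing denominators thus leaves a
   polynomial identity. *)
Require Import Defs.
From mathcomp Require Import all_boot all_order all_algebra.
From mathcomp Require Import reals ring.

Set Implicit Arguments.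
Unset Strict Implicit.
Unset Printing Implicit Defensive.

Local Open Scope ring_scope.

Theorem lemma5p45 (R : realType) (p0 p1 p2 p3 : R * R)
  (hp : uniq [:: p0; p1; p2; p3])
  (hx : uniq [:: p0.1; p1.1; p2.1; p3.1]) :
  let a1 := slope p0 p1 in
  let a2 := slope p0 p2 in
  let a3 := slope p0 p3 in
  let a12 := slope p1 p2 in
  let a13 := slope p1 p3 in
  let a23 := slope p2 p3 in
  (a1 - a12) * (a2 - a23) * (a3 - a13)
    - (a1 - a13) * (a2 - a12) * (a3 - a23) = 0.
Proof.
(* Distinctness of the abscissas unfolds into six inequations, one for each [i < j]: exactly the six
   slope denominators. *)
move: hx; rewrite /= !inE !negb_or andbT.
move=> /and3P[/and3P[x01 x02 x03] /andP[x12 x13] x23].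
(* [field] clears the denominators and checks the polynomial identity, leaving their
   nonvanishing. *)
cbv zeta; rewrite /slope; field.
(* The denominator of [slope p q] is [q.1 - p.1], whereas uniqueness gives [p.1 != q.1]; hence the
   flip by [eq_sym]. *)
by rewrite !GRing.subr_eq0; do ?[apply/andP; split]; rewrite eq_sym.
Qed.
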